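(* Let $\ell\ne p$ be a prime and let $e_i$ be the multiplicity of $\ell^i$ as an elementary divisor of the adjacency matrix $A'$ of the Grassmann graph $\Gamma'$ on the $2$-dimensional subspaces of $V=\mathbb F_q^n$ ($n\ge4$, $q=p^t$). Put $f=[n]-1$, $g=\left[\begin{smallmatrix}n\\2\end{smallmatrix}\right]_q-[n]$, $k'=q(q+1)[n-2]$ and $r=q^2[n-3]-1$. In each case below, $e_i=0$ for all $i$ not listed. (A) Suppose $\ell\nmid q+1$. If $\ell\nmid k'r$, then $\ell\nmid|S(\Gamma')|$. Otherwise $\ell$ divides exactly one of $k'$, $r$, and: (i) if $\ell\mid k'$, with $a=v_\ell(k')$: $e_a=1$, $e_0=f+g$; (ii) if $\ell\mid r$, with $a=v_\ell(r)$: $e_a=f$, $e_0=g+1$. (B) Suppose $\ell\mid q+1$ and $n$ is even. Let $h=[(n-2)/2]_{q^2}$, $a=v_\ell(q+1)$, $b=v_\ell(qh-1)$, $c=v_\ell(h)$ (at least one of $b$, $c$ is $0$). (a) If $b=c=0$: $e_{2a}=f$, $e_a=g-f+2$, $e_0=f-1$. (b) If $b>0$ (so $c=0$): $e_{2a+b}=f$, $e_a=g-f+2$, $e_0=f-1$. (c) If $c>0$ (so $b=0$): $e_{2a+c}=1$, $e_{2a}=f-1$, $e_a=g-f+2$, $e_0=f-1$. (C) Suppose $\ell\mid q+1$ and $n$ is odd. With $a=v_\ell(q+1)$: $e_a=g+1$, $e_0=f$.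
   Context: Let $p$ be a prime, $q=p^t$ with $t\ge1$, $n\ge4$, and $V$ an $n$-dimensional vector space over $\mathbb F_q$. Notation: $[m]=\frac{q^m-1}{q-1}$, $[m]_{q^2}=\frac{q^{2m}-1}{q^2-1}$, and $\left[\begin{smallmatrix}m\\k\end{smallmatrix}\right]_q$ is the number of $k$-dimensional subspaces of $\mathbb F_q^m$; $v_\ell$ is the $\ell$-adic valuation. The Grassmann graph $\Gamma'$ has as vertices the $2$-dimensional subspaces of $V$, two distinct ones being adjacent when their intersection is nonzero; $A'$ is its adjacency matrix. The Smith group $S(\Gamma')$ is the (finite) cokernel of $A'$ over $\mathbb Z$. The multiplicity of $\ell^i$ as an elementary divisor of an integer matrix is the number of nonzero diagonal entries of its Smith normal form whose $\ell$-adic valuation is exactly $i$. *)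

(* Defs.v *)
From HB Require Import structures.
From mathcomp Require Import all_boot all_order all_algebra.
From mathcomp Require Import boolp.

Set Implicit Arguments.
Unset Strict Implicit.
Unset Printing Implicit Defensive.

Import GRing.Theory VectorInternalTheory.

HB.instance Definition _ (F : finFieldType) (V : vectType F) :=
  [Countable of {vspace V} by <:].
HB.instance Definition _ (F : finFieldType) (V : vectType F) :=
  [Finite of {vspace V} by <:].

(* [m] = (q ^ m - 1) / (q - 1); the division is exact for 1 < q.  Taking q ^ 2
   for q gives [m]_{q^2} = (q ^ (2 m) - 1) / (q ^ 2 - 1). *)
Definition qint (q m : nat) : nat := (q ^ m - 1) %/ (q - 1).

Definition gauss_binom (F : finFieldType) (m k : nat) : nat :=
  #|[set U : {vspace 'rV[F]_m} | \dim U == k]|.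

Section Grassmann.
Variables (F : finFieldType) (V : vectType F).

Definition plane : predArgType := {U : {vspace V} | \dim U == 2}.

Definition grassmann_adj : rel plane :=
  fun U W => (U != W) && ((val U :&: val W)%VS != 0%VS).

End Grassmann.

Definition adjmx (T : finType) (e : rel T) : 'M[int]_#|T| :=
  \matrix_(i, j) ((e (enum_val i) (enum_val j))%:R)%R.

Definition grassmann_mx (F : finFieldType) (V : vectType F) :
    'M[int]_#|plane V| :=
  adjmx (@grassmann_adj F V).

(* d lists the diagonal of a Smith normal form of M.  Signs are not normalised:
   d is unique only up to signs, which do not affect valuations. *)
Definition smith_diagonal m n (M : 'M[int]_(m, n)) (d : seq int) : Prop :=
  [/\ size d = minn m n, sorted dvdz d
    & exists L : 'M[int]_m, exists R : 'M[int]_n,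
      [/\ L \in unitmx, R \in unitmx
        & M = (L *m (\matrix_(i, j) (d`_i *+ (i == j :> nat))) *m R)%R]].

Lemma smith_diagonal_exists m n (M : 'M[int]_(m, n)) :
  exists d, smith_diagonal M d.
Proof.
have [L uL [R uR [d sd ->]]] := int_Smith_normal_form M.
exists (mkseq (nth 0%R d) (minn m n)); split; first by rewrite size_mkseq.
- apply/(sortedP 0%R) => i; rewrite size_mkseq => lt_i.
  rewrite !nth_mkseq //; last exact: ltnW.
  case: (ltnP i.+1 (size d)) => [lt_id | ge_id].
    by move/(sortedP 0%R): sd; apply.
  by rewrite (nth_default _ ge_id); apply: dvdz0.
- exists L, R; split=> //; congr (_ *m _ *m _)%R; apply/matrixP => i j.
  rewrite !mxE; case: eqP => [eq_ij | //].
  by rewrite nth_mkseq // leq_min ltn_ord eq_ij ltn_ord.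
Qed.

Definition elem_div_mult (d : seq int) (l i : nat) : nat :=
  count (fun x : int => (x != 0%R) && (logn l `|x|%N == i)) d.

Section Cokernel.
Variables (m n : nat) (M : 'M[int]_(m, n)).

Definition int_image : {pred 'cV[int]_m} :=
  [pred v | `[< exists u : 'cV[int]_n, v = (M *m u)%R >]].

Lemma int_image_zmod_closed : zmod_closed int_image.
Proof.
split; first by apply/asboolP; exists 0%R; rewrite mulmx0.
move=> _ _ /asboolP[u ->] /asboolP[v ->].
by apply/asboolP; exists (u - v)%R; rewrite mulmxBr.
Qed.
HB.instance Definition _ :=
  GRing.isZmodClosed.Build _ int_image int_image_zmod_closed.

Definition coker_int : zmodType := {ideal_quot int_image}%type.

End Cokernel.

Definition smith_group (F : finFieldType) (V : vectType F) : zmodType :=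
  coker_int (grassmann_mx V).

Definition has_order (T : Type) (m : nat) : Prop :=
  exists f : T -> 'I_m, bijective f.

(* Main.v *)
Require Import Defs.
From mathcomp Require Import all_boot all_order all_algebra.
From mathcomp Require Import boolp finfield generic_quotient ring_quotient.
From mathcomp Require Import ring zify.

(* Put s = q + 1 and let B be the incidence matrix of lines (2-spaces) against
   points, so that B B^T = A' + s I and B^T B = (r + s) I + J.  By Sylvester's
   determinant identity |det A'| = s^g r^f k', which is the sum of the l-adic
   valuations of the elementary divisors.  It is therefore enough to bound from
   below, for each i, the number of elementary divisors divisible by l^i, and the
   bounds must then be equalities.  A lower bound c comes from c integer vectors
   x, independent modulo l, such that A' x = 0 modulo l^i, or from a
   factorisation of A' modulo l^i through N - c dimensions.

   The only delicate case is l | s with n even, where r = s u.  For points p, p0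
   and a 3-space W containing them, let z be the indicator of the lines of W
   through p minus that of the lines of W through p0.  Then B^T z = q (p - p0),
   and x = q B (p - p0) - s u z satisfies A' x = s^2 u z. *)

Set Implicit Arguments.
Unset Strict Implicit.
Unset Printing Implicit Defensive.

Import Order.TTheory GRing.Theory Num.Theory.

(** * Lower bounds for elementary divisor multiplicities *)

Local Open Scope ring_scope.

Section PrimePowerDivisors.

Variables (l : nat) (l_prime : prime l).

Lemma Fp_int_eq0 (z : int) : ((z%:~R : 'F_l) == 0) = (l%:Z %| z)%Z.
Proof. by rewrite (dvdz_pcharf (pchar_Fp l_prime)). Qed.

Lemma pfactor_dvdzMr i (x y : int) :
  ~~ (l%:Z %| x)%Z -> ((l ^ i)%:Z %| x * y)%Z = ((l ^ i)%:Z %| y)%Z.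
Proof.
rewrite !dvdzE abszM /= => nlx; apply: Gauss_dvdr.
by rewrite coprimeXl // prime_coprime.
Qed.

Lemma mxrank_diag_le (F : fieldType) n (u : 'rV[F]_n) :
  (\rank (diag_mx u) <= #|[pred i | u 0%R i != 0%R]|)%N.
Proof.
have -> : diag_mx u = \sum_(i | u 0 i != 0) u 0 i *: delta_mx i i.
  rewrite diag_mx_sum_delta [RHS]big_mkcond; apply: eq_bigr => i _.
  by case: eqP => // ->; rewrite scale0r.
rewrite -sum1_card.
apply: (big_ind2 (fun (A : 'M_n) k => (\rank A <= k)%N)).
- by rewrite mxrank0.
- by move=> A a B b hA hB; rewrite (leq_trans (mxrank_add _ _)) ?leq_add.
- by move=> i nz; rewrite mxrank_scale_nz // mxrank_delta.
Qed.

(* Writing M = L D R, every column of X L at a position where l ^ i does not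
   divide the diagonal entry vanishes modulo l, so the rank of X modulo l is a
   lower bound for the number of the other positions. *)
Lemma smith_count_dvd_ge n k j (M : 'M[int]_n) d i
    (X Y : 'M[int]_(k, n)) (W : 'M[int]_(n, k)) (c : int)
    (U : 'M[int]_(k, j)) (V : 'M[int]_(j, k)) (H : 'M[int]_k) :
  smith_diagonal M d -> X *m M = (l ^ i)%:Z *: Y ->
  ~~ (l%:Z %| c)%Z -> X *m W = c%:M + U *m V + l%:Z *: H ->
  (k <= count (fun x => (l ^ i)%:Z %| x)%Z d + j)%N.
Proof.
case=> sz_d _ [L [R [uL uR defM]]] XM nlc XW.
pose phi m1 m2 (A : 'M[int]_(m1, m2)) : 'M['F_l]_(m1, m2) := map_mx intr A.
pose X' := X *m L.
have X'd a b : X' a b * d`_b = (l ^ i)%:Z * (Y *m invmx R) a b.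
  have: X' *m \matrix_(i, j) (d`_i *+ (i == j :> nat)) =
        (l ^ i)%:Z *: (Y *m invmx R).
    rewrite -[LHS](mulmxK uR) -!mulmxA (mulmxA L) (mulmxA _ R) -defM mulmxA.
    by rewrite XM scalemxAl.
  move/matrixP/(_ a b); rewrite [LHS]mxE [RHS]mxE => <-.
  rewrite (bigD1 b) //= mxE eqxx big1 ?addr0 // => b' nb.
  by rewrite mxE (_ : (b' == b :> nat) = false) ?mulr0n ?mulr0 //; apply/negbTE.
pose u : 'rV['F_l]_n := \row_b ((l ^ i)%:Z %| d`_b)%Z%:R.
have phiX' : phi _ _ X' = phi _ _ X' *m diag_mx u.
  apply/matrixP => a b; rewrite mul_mx_diag [RHS]mxE [u _ _]mxE.
  case: (boolP ((l ^ i)%:Z %| d`_b)%Z) => [_|nd]; first by rewrite mulr1.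
  rewrite mulr0 [LHS]mxE; apply/eqP; rewrite Fp_int_eq0.
  apply: contraR nd => nl; rewrite -(pfactor_dvdzMr _ _ nl) X'd.
  exact: dvdz_mulr.
have rk_u : (\rank (diag_mx u) <= count (fun x => (l ^ i)%:Z %| x)%Z d)%N.
  apply: leq_trans (mxrank_diag_le u) _.
  have -> : d = [seq d`_(val b) | b <- enum 'I_n].
    by rewrite -[LHS](mkseq_nth 0) sz_d minnn /mkseq -val_enum_ord -map_comp.
  rewrite count_map cardE size_filter.
  rewrite enumT; apply: sub_count => b /=; rewrite !inE mxE.
  by case: (_ %| _)%Z; rewrite ?eqxx.
have rkX : (\rank (phi _ _ X *m phi _ _ W) <= \rank (diag_mx u))%N.
  have -> : phi _ _ X = phi _ _ X' *m phi _ _ (invmx L).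
    by rewrite -map_mxM mulmxK.
  by rewrite phiX' -!mulmxA; apply: leq_trans (mxrankM_maxr _ _) (mxrankM_maxl _ _).
(* [c] is invertible modulo [l], so the scalar matrix has full rank [k]; the error term [U *m V]
   passes through [j] dimensions and accounts for at most [j] of it. *)
have -> : k = \rank ((c%:~R)%:M : 'M['F_l]_k).
  by rewrite -scalemx1 mxrank_scale_nz ?mxrank1 // Fp_int_eq0.
have -> : (c%:~R)%:M = phi _ _ X *m phi _ _ W + (- phi _ _ U *m phi _ _ V).
  rewrite -map_mxM XW !map_mxD map_mxM map_scalar_mx mulNmx.
  have -> : map_mx intr (l%:Z *: H) = 0 :> 'M['F_l]_k.
    by apply/matrixP => a b; rewrite !mxE; apply/eqP; rewrite Fp_int_eq0 dvdz_mulr.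
  by rewrite addr0 addrK.
apply: leq_trans (mxrank_add _ _) _; apply: leq_add.
  exact: leq_trans rkX rk_u.
by rewrite (leq_trans (mxrankM_maxr _ _)) ?rank_leq_row.
Qed.

(** With [L] from a Smith form of [A], the rows of [invmx L] beyond the first [k] annihilate [A], so
    they multiply [M] into multiples of [l ^ i]. Their independence shows in [C = 1 - pid_mx k],
    whose second term passes through [k] dimensions. *)
Lemma smith_count_dvd_ge_factor n k (M : 'M[int]_n) d i
    (A : 'M[int]_(n, k)) (B : 'M[int]_(k, n)) (H : 'M[int]_n) :
  smith_diagonal M d -> M = A *m B + (l ^ i)%:Z *: H ->
  (n <= count (fun x => (l ^ i)%:Z %| x)%Z d + k)%N.
Proof.
move=> dM defM; have [L uL [R uR [s _ defA]]] := int_Smith_normal_form A.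
pose C : 'M[int]_n := copid_mx k.
apply: (@smith_count_dvd_ge _ _ k _ _ i (C *m invmx L) (C *m invmx L *m H) L 1
  (- (pid_mx k : 'M_(n, k))) (pid_mx k) 0 dM).
- rewrite defM mulmxDr -scalemxAr; suff -> : C *m invmx L *m (A *m B) = 0.
    by rewrite add0r.
  rewrite mulmxA defA -!mulmxA (mulmxA (invmx L)) mulVmx // mul1mx mulmxA.
  suff -> : C *m (\matrix_(i0, j) (s`_i0 *+ (i0 == j :> nat)) : 'M_(n, k)) = 0.
    by rewrite mul0mx.
  apply/matrixP => a b; rewrite !mxE big1 // => c _; rewrite !mxE.
  case: (c == b :> nat) / eqP => [eqcb|]; last by rewrite mulr0n mulr0.
  case: (a =P c) => [->|ac]; first by rewrite eqxx eqcb ltn_ord subrr mul0r.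
  by rewrite (_ : (a == c :> nat) = false) ?subrr ?mul0r //; apply/eqP => /val_inj.
- by rewrite dvdzE /= Euclid_dvd1.
- rewrite mulmxKV // scaler0 addr0 mulNmx pid_mx_id //.
Qed.

End PrimePowerDivisors.

(** * From lower bounds on tail counts to exact multiplicities *)

Section CountGe.
Local Open Scope nat_scope.

Lemma count_geq_ltn_eq (s : seq nat) i :
  count (leq i) s = count_mem i s + count (leq i.+1) s.
Proof.
elim: s => //= x s ->; rewrite [x == i]eq_sym [i <= x]leq_eqVlt.
by case: eqP => [->|_] /=; rewrite ?ltnn /=; lia.
Qed.

(** Each entry [x] adds one to exactly the first [x] tail counts. *)
Lemma sumn_count_geq (s : seq nat) K :
  all (fun x => x <= K) s -> sumn s = \sum_(i < K) count (leq i.+1) s.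
Proof.
elim: s => /= [_|x s IH /andP[lex /IH->]]; first by rewrite big1.
rewrite big_split /=; congr (_ + _).
rewrite (eq_bigr (fun i : 'I_K => if i < x then 1 else 0)).
  by rewrite -big_mkcond -(big_ord_widen _ (fun=> 1)) // sum1_card card_ord.
by move=> i _; case: ltnP.
Qed.

(** The two sums are the totals of the tail counts, so termwise inequalities between tail counts
    must all be equalities; multiplicities are differences of consecutive tail counts. *)
Lemma count_mem_of_count_geq (v w : seq nat) :
    size v = size w -> sumn v = sumn w ->
    (forall k, count (leq k.+1) w <= count (leq k.+1) v) ->
  forall i, count_mem i v = count_mem i w.
Proof.
move=> eq_sz eq_sum le_wv.
pose K := \max_(x <- v ++ w) x.
have leK : all (fun x => x <= K) (v ++ w).
  by apply/allP => x x_in; rewrite /K (big_rem x) //= leq_maxl.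
have {}leK L : K <= L -> all (fun x => x <= L) v /\ all (fun x => x <= L) w.
  move=> KL; apply/andP; rewrite -all_cat; apply/allP => x.
  by move/(allP leK)/leq_trans; apply.
have eq_count k : count (leq k.+1) w = count (leq k.+1) v.
  (* Summing up to [maxn K k.+1] rather than [K] keeps [k] among the indices. *)
  have [av aw] := leK _ (leq_maxl K k.+1).
  move: eq_sum; rewrite (sumn_count_geq av) (sumn_count_geq aw) => /eqP.
  rewrite eq_sym => eq_sum.
  have /leqif_sum : forall i : 'I_(maxn K k.+1), true ->
    count (leq i.+1) w <= count (leq i.+1) v ?= iff
      (count (leq i.+1) w == count (leq i.+1) v) by move=> i _; split.
  case=> _; rewrite eq_sum => /esym/forallP.
  have lt_k : k < maxn K k.+1 by rewrite leq_max leqnn orbT.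
  by move/(_ (Ordinal lt_k))/eqP.
have eq_count0 k : count (leq k) w = count (leq k) v.
  by case: k => [|k]; last exact: eq_count; rewrite !count_predT.
move=> i; have := count_geq_ltn_eq v i; rewrite -eq_count0 -eq_count.
by rewrite count_geq_ltn_eq => /addIn.
Qed.

End CountGe.

(** * Determinants, Smith forms and Sylvester's identity *)

Lemma smith_abs_det n (M : 'M[int]_n) d :
  smith_diagonal M d -> `|\det M|%N = (\prod_(x <- d) `|x|%N)%N.
Proof.
case=> sz_d _ [L [R [uL uR ->]]].
rewrite !det_mulmx !abszM.
have abs1 (A : 'M[int]_n) : A \in unitmx -> `|\det A|%N = 1%N.
  by rewrite unitmxE qualifE /= => /orP[] /eqP->.
rewrite (abs1 _ uL) (abs1 _ uR) mul1n muln1.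
have -> : \matrix_(i, j) (d`_i *+ (i == j :> nat)) = diag_mx (\row_i d`_i) :> 'M_n.
  by apply/matrixP => i j; rewrite !mxE.
rewrite det_diag (big_nth 0) sz_d minnn big_mkord.
rewrite (big_morph absz abszM (erefl : absz 1 = 1%N)).
by apply: eq_bigr => i _; rewrite mxE.
Qed.

Lemma elem_div_multE l i (d : seq int) :
  all (fun x => x != 0) d ->
  elem_div_mult d l i = count_mem i [seq logn l `|x|%N | x <- d].
Proof.
move=> /allP nzd; rewrite /elem_div_mult count_map; apply: eq_in_count => x /nzd /= ->.
by [].
Qed.

(** [w] is the predicted list of valuations. The determinant supplies the equality of sums that
    turns one-sided bounds into exact multiplicities. *)
Lemma smith_elem_div_mult n (M : 'M[int]_n) d (l : nat) (w : seq nat) :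
    prime l -> smith_diagonal M d -> \det M != 0 -> size w = n ->
    logn l `|\det M|%N = sumn w ->
    (forall k, count (leq k.+1) w <= count (fun x => ((l ^ k.+1)%:Z %| x)%Z) d)%N ->
  forall i, elem_div_mult d l i = count_mem i w.
Proof.
move=> l_prime dM nzM sz_w sum_w le_w i.
have nzd : all (fun x => x != 0) d.
  apply/allP => x xd; apply: contraNneq nzM => x0; rewrite -absz_eq0.
  by rewrite (smith_abs_det dM) (big_rem x) //= x0 mul0n.
rewrite elem_div_multE //; apply: count_mem_of_count_geq.
- by rewrite size_map sz_w; case: dM => ->; rewrite minnn.
- rewrite -sum_w (smith_abs_det dM).
  suff []: (0 < \prod_(x <- d) `|x|)%N /\
      sumn [seq logn l `|x|%N | x <- d] = logn l (\prod_(x <- d) `|x|)%N by [].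
  elim: (d) nzd => [|x s IH] /=; first by rewrite big_nil logn1.
  case/andP=> nzx /IH[gt0 ->].
  by rewrite big_cons muln_gt0 absz_gt0 nzx gt0 lognM ?absz_gt0.
- move=> k; rewrite count_map; apply: leq_trans (le_w k) _.
  apply: eq_leq; apply: eq_in_count => x /(allP nzd) nzx /=.
  by rewrite dvdzE /= pfactor_dvdn ?absz_gt0.
Qed.

(** The matrix with blocks [s], [A], [B], [1] becomes block triangular in two ways, clearing [B] or
    clearing [A]. The powers of [s] keep the identity valid over the integers, where [s] need not be
    invertible. *)
Lemma det_sub_mul_comm n k (s : int) (A : 'M[int]_(n, k)) (B : 'M[int]_(k, n)) :
  s ^+ k * \det (s%:M - A *m B) = s ^+ n * \det (s%:M - B *m A).
Proof.
have := det_mulmx (block_mx 1%:M 0 (- B) s%:M) (block_mx s%:M A B 1%:M).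
rewrite mulmx_block !mul1mx !mul0mx !addr0 mulmx1.
rewrite mulNmx mul_mx_scalar mul_scalar_mx addNr mulNmx addrC.
rewrite det_ublock det_lblock det1 mul1r !det_scalar addrC.
have -> : \det (block_mx s%:M A B 1%:M) = \det (s%:M - A *m B).
  have := det_mulmx (block_mx 1%:M (- A) 0 1%:M) (block_mx s%:M A B 1%:M).
  rewrite mulmx_block !mul1mx !mul0mx !add0r mulNmx mulmx1 addrN.
  by rewrite det_ublock det_lblock !det1 !mul1r mulr1 => ->.
by rewrite [_ + s%:M]addrC => ->.
Qed.

(** * Order of the cokernel of a nonsingular matrix *)

Section Cokernel.
Local Open Scope quotient_scope.

(** In the coordinates [invmx L *m v], the image consists of the vectors whose [i]-th entry is
    divisible by [d_i]. Residues of the coordinates thus identify the cokernel with a product of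
    intervals of lengths [|d_i|]. *)
Lemma coker_int_order n (M : 'M[int]_n) :
  \det M != 0 -> has_order (coker_int M) `|\det M|%N.
Proof.
move=> nzM; have [d dM] := smith_diagonal_exists M.
have [sz_d _ [L [R [uL uR defM]]]] := dM.
have card_d : `|\det M|%N = (\prod_(i < n) `|(d`_i)%R|)%N.
  by rewrite (smith_abs_det dM) (big_nth 0) sz_d minnn big_mkord.
have nzd (i : 'I_n) : d`_i != 0.
  apply: contraNneq nzM => d0; rewrite -absz_eq0 card_d.
  by rewrite (bigD1 i) //= d0 mul0n.
pose D : 'M[int]_n := \matrix_(i, j) (d`_i *+ (i == j :> nat)).
have Du (u : 'cV[int]_n) i : (D *m u) i 0 = d`_i * u i 0.
  rewrite mxE (bigD1 i) //= mxE eqxx big1 ?addr0 // => j ji.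
  by rewrite mxE (_ : (i == j :> nat) = false) ?mul0r // eq_sym; apply/negbTE.
have colB (u v : 'cV[int]_n) i : (u - v) i ord0 = u i ord0 - v i ord0.
  by rewrite !mxE.
have imageP v : (v \in int_image M) = [forall i, (d`_i %| (invmx L *m v) i ord0)%Z].
  apply/asboolP/forallP => [[u ->] i|dvd].
    by rewrite defM -!mulmxA mulKmx // Du dvdz_mulr.
  exists (invmx R *m \col_i ((invmx L *m v) i ord0 %/ d`_i)%Z).
  rewrite defM -!mulmxA mulKVmx // -[LHS](mulKVmx uL); congr (L *m _).
  apply/colP => i; rewrite Du [(\col__ _) _ _]mxE mulrC divzK //; exact: dvd.
have res_lt (i : 'I_n) (z : int) : (`|(z %% d`_i)%Z| < `|(d`_i)%R|)%N.
  by rewrite -ltz_nat gez0_abs ?modz_ge0 // ltz_mod.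
pose T := {dffun forall i : 'I_n, 'I_`|(d`_i)%R|%N}.
pose Q : quotType _ := {ideal_quot (int_image M)}%type.
pose f (c : Q) : T :=
  [ffun i : 'I_n => Ordinal (res_lt i ((invmx L *m repr c) i 0)) : 'I_`|(d`_i)%R|%N].
pose g (t : T) : Q := \pi_Q (L *m \col_i (t i : nat)%:Z).
have fK : cancel f g.
  move=> c; rewrite -[RHS]reprK; apply/eqP; rewrite -Quotient.idealrBE imageP.
  apply/forallP => i; rewrite mulmxBr mulKmx // colB mxE ffunE /= gez0_abs ?modz_ge0 // -eqz_mod_dvd.
  by rewrite modz_mod.
have gK : cancel g f.
  move=> t; apply/ffunP => i; rewrite ffunE; apply/val_inj/eqP => /=.
  rewrite -eqz_nat gez0_abs ?modz_ge0 //.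
  have : repr (g t) - L *m \col_i (t i : nat)%:Z \in int_image M.
    by rewrite Quotient.idealrBE reprK.
  rewrite imageP => /forallP/(_ i); rewrite mulmxBr mulKmx // colB.
  rewrite [(\col__ _) _ _]mxE -eqz_mod_dvd => /eqP->.
  by rewrite -modz_abs modz_nat modn_small.
have card_T : #|T| = `|\det M|%N.
  rewrite card_dep_ffun card_d foldrE big_map -big_enum /=.
  by apply: eq_bigr => i _; rewrite card_ord.
rewrite -card_T; exists (enum_rank \o f); apply: bij_comp; first exact: enum_rank_bij.
by exists g.
Qed.

End Cokernel.

(** * Points and lines of a finite vector space *)

Section Qint.
Local Open Scope nat_scope.
Variable q : nat.
Hypothesis q_gt1 : 1 < q.

Lemma qint_mul m : (q - 1) * qint q m = q ^ m - 1.
Proof.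
rewrite /qint mulnC divnK // subn1.
elim: m => [|m IH]; first by rewrite expn0 dvdn0.
have -> : q ^ m.+1 - 1 = q * (q ^ m - 1) + (q - 1).
  have : 0 < q ^ m by rewrite expn_gt0 ltnW.
  by rewrite expnS mulnBr muln1; nia.
by rewrite dvdn_add ?dvdn_mull // subn1.
Qed.

Lemma qintS m : qint q m.+1 = 1 + q * qint q m.
Proof.
have /eqP h : (q - 1) * qint q m.+1 == (q - 1) * (1 + q * qint q m).
  have := qint_mul m; have := qint_mul m.+1; rewrite expnS => -> H.
  have : 0 < q ^ m by rewrite expn_gt0 ltnW. nia.
by apply/eqP; move/eqP: h; rewrite eqn_pmul2l // subn_gt0.
Qed.

Lemma qint0 : qint q 0 = 0.
Proof. by rewrite /qint expn0 subnn div0n. Qed.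

End Qint.

Section Subspaces.

Variables (F : finFieldType) (V : vectType F).
Local Notation q := #|F|.
Local Open Scope vspace_scope.

Definition point : predArgType := {U : {vspace V} | \dim U == 1}.

Lemma dim_point (p : point) : \dim (val p) = 1%N.
Proof. by case: p => U /= /eqP. Qed.

Lemma dim_plane (L : plane V) : \dim (val L) = 2%N.
Proof. by case: L => U /= /eqP. Qed.

Lemma cardF_gt1 : (1 < q)%N.
Proof. exact: finNzRing_gt1. Qed.

Lemma card_vspace_nz (W : {vspace V}) :
  #|[set v : finvect_type V | (v \in W) && (v != (0%R : V))]| = (q ^ \dim W - 1)%N.
Proof.
suff h : #|[pred v : finvect_type V | v \in W]| = (q ^ \dim W)%N.
  have W0 : (0%R : V) \in [pred v : finvect_type V | v \in W] by exact: mem0v.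
  rewrite -h [in RHS](@cardD1 (finvect_type V) (0%R : V)) W0 add1n subn1 /=.
  by apply: eq_card => v; rewrite !inE andbC.
by case: V W => T cT W; exact: (@card_vspace F (finvect_type (Vector.Pack cT)) cT W).
Qed.

(** The nonzero vectors of [W] are partitioned by the point they span, and each point contains
    [q - 1] of them. *)
Lemma card_points (W : {vspace V}) :
  #|[set p : point | val p <= W]| = qint q (\dim W).
Proof.
have q1 := cardF_gt1.
suff h : (#|[set U : {vspace V} | (\dim U == 1%N) && (U <= W)%VS]| * (q - 1) =
          q ^ \dim W - 1)%N.
  rewrite /qint -h mulnK ?subn_gt0 // -(card_imset _ val_inj).
  apply: eq_card => U; rewrite [RHS]inE; apply/imsetP/andP.
    by case=> p; rewrite inE => pW ->; rewrite dim_point.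
  by case=> dU UW; exists (Sub U dU : point); rewrite ?inE.
rewrite -card_vspace_nz -sum_nat_const -[RHS]sum1_card.
rewrite (partition_big (fun v : finvect_type V => <[v : V]>)
  (mem [set U : {vspace V} | (\dim U == 1%N) && (U <= W)%VS])) /=; last first.
  move=> v; rewrite !inE -memvE dim_vline => /andP[-> ->]; by [].
apply: eq_bigr => U; rewrite inE => /andP[/eqP dU UW].
have := card_vspace_nz U; rewrite dU expn1 => <-.
rewrite sum1_card; apply: eq_card => v.
rewrite inE [RHS]unfold_in inE; apply/andP/andP => [[vU v0]|[/andP[vW v0] /eqP <-]]; last first.
  by rewrite memv_line.
rewrite (subvP UW) // v0; split=> //.
by rewrite eqEdim -memvE vU dU dim_vline v0.
Qed.

Lemma point_neq_dim (p p' : point) : p != p' -> \dim (val p + val p') = 2%N.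
Proof.
move=> neq; have h := dimv_sum_cap (val p) (val p').
rewrite !dim_point in h.
suff /eqP d0 : \dim (val p :&: val p') == 0%N by rewrite d0 addn0 in h.
rewrite -leqn0 leqNgt; apply: contraNN neq => d1.
have d1' : val p :&: val p' == val p by rewrite eqEdim capvSl dim_point.
have d2' : val p :&: val p' == val p' by rewrite eqEdim capvSr dim_point.
by apply/eqP/val_inj; rewrite -[LHS](eqP d1') (eqP d2').
Qed.

(** [U] will be a sum of two points, equal or distinct; [W] will be the whole space for [B^T *m B]
    and a 3-space for the vectors z. *)
Definition lines_between (U W : {vspace V}) : nat :=
  #|[set L : plane V | U <= val L <= W]|.

Lemma lines_between2 (U W : {vspace V}) :
  \dim U = 2%N -> lines_between U W = (U <= W).
Proof.
move=> dU; rewrite /lines_between; have dU' : \dim U == 2%N by apply/eqP.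
have eqU (L : plane V) : (U <= val L) = (L == exist _ U dU').
  apply/idP/eqP => [UL|->//]; apply/val_inj => /=; apply/esym/eqP.
  by rewrite eqEdim UL dU dim_plane.
case: (boolP (U <= W)) => UW /=.
  rewrite (_ : [set _ | _] = [set exist _ U dU']) ?cards1 //.
  by apply/setP=> L; rewrite !inE eqU; case: eqP => [->|].
rewrite (_ : [set _ | _] = set0) ?cards0 //; apply/setP => L; rewrite !inE.
by apply: contraNF UW => /andP[]; exact: subv_trans.
Qed.

(* Count the pairs (p', L) with p + p' <= L <= W in two ways. *)
Lemma lines_between1 (p : point) (W : {vspace V}) m :
  val p <= W -> \dim W = m.+1 -> lines_between (val p) W = qint q m.
Proof.
move=> pW dW; have q1 := cardF_gt1.
(* On the left, [p' = p] contributes every line and each of the other [q * qint q m] points of [W]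
   exactly one; on the right, each line carries [q.+1] points. *)
suff h : (lines_between (val p) W + q * qint q m = lines_between (val p) W * q.+1)%N.
  by apply/eqP; rewrite -(eqn_pmul2l (ltnW q1)); apply/eqP; lia.
transitivity (\sum_(p' : point | (val p' <= W)%VS) lines_between (val p + val p') W)%N.
  rewrite (bigD1 p) //= addvv; congr addn.
  rewrite (eq_bigr (fun=> 1%N)) => [|p' /andP[p'W neq]]; last first.
    by rewrite lines_between2 ?subv_add ?pW ?p'W ?point_neq_dim // eq_sym.
  rewrite sum1_card; apply/eqP.
  have := card_points W; rewrite dW qintS // (cardsD1 p) inE pW add1n => -[<-].
  by apply/eqP/eq_card => p'; rewrite !inE andbC.
rewrite (eq_bigr (fun p' : point =>
    \sum_(L : plane V | (val p <= val L <= W)%VS) (val p' <= val L)%VS)%N) => [|p' _].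
  rewrite exchange_big /= /lines_between -sum1_card big_distrl /=.
  apply: eq_big => [L|L /andP[pL LW]]; first by rewrite inE.
  rewrite mul1n -big_mkcondr sum1_card.
  have := card_points (val L); rewrite dim_plane !qintS // qint0 muln0 addn0 muln1.
  rewrite add1n => <-; apply: eq_card => p'; rewrite [RHS]inE unfold_in /=.
  by apply/andP/idP => [[]//|p'L]; rewrite (subv_trans p'L LW).
rewrite /lines_between -sum1_card -big_mkcondr; apply: eq_bigl => L.
by rewrite inE subv_add -andbA andbCA andbC -!andbA [(val L <= W)%VS && _]andbC.
Qed.

End Subspaces.

(** * The incidence matrix of lines against points *)

Section Incidence.

Variables (F : finFieldType) (V : vectType F).
Local Notation q := #|F|.
Local Open Scope vspace_scope.

Lemma subspace_of_dim (U : {vspace V}) k :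
  (\dim U <= k <= \dim {:V})%N -> exists2 W : {vspace V}, U <= W & \dim W = k.
Proof.
elim: k => [|k IH] /andP[Uk kV].
  by exists U => //; apply/eqP; rewrite -leqn0.
case: (ltngtP (\dim U) k.+1) Uk => // [Uk|eqUk] _; last by exists U.
have [|W UW dW] := IH; first by rewrite -ltnS Uk ltnW.
have /subvPn[v _ vW] : ~~ ({:V} <= W) 
  by apply/negP => /dimvS; rewrite dW leqNgt kV.
exists (W + <[v]>); first exact: subv_trans UW (addvSl _ _).
rewrite dimv_disjoint_sum; last first.
  apply/eqP; rewrite -dimv_eq0 -leqn0 leqNgt; apply: contra vW => d_gt0.
  rewrite memvE; suff /eqP <- : W :&: <[v]> == <[v]> by exact: capvSl.
  by rewrite eqEdim capvSr (leq_trans _ d_gt0) // dim_vline leq_b1.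
rewrite dim_vline dW (_ : v != 0%R) ?addn1 //.
by apply: contraNneq vW => ->; exact: mem0v.
Qed.

Local Notation point := (point V).

Definition incidence_mx : 'M[int]_(#|plane V|, #|point|) :=
  (\matrix_(i < #|plane V|, j < #|point|)
    ((val (enum_val j) <= val (enum_val i))%VS)%:R)%R.

Local Notation B := incidence_mx.

Lemma sum_bool_card (T : finType) (A : pred T) :
  (\sum_(i < #|T|) (A (enum_val i))%:R)%R = #|[set x | A x]| :> int.
Proof.
rewrite -(big_enum_val (fun x => (A x)%:R%R)) /= -natr_sum natz.
by rewrite -big_mkcond sum1_card; congr Posz; apply: eq_card => x; rewrite inE unfold_in.
Qed.

(** An entry counts the points of the intersection of two lines: [q + 1] on the diagonal, and
    elsewhere one or none according to adjacency. *)
Lemma incidence_mul_tr :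
  (B *m B^T = grassmann_mx V + (q + 1)%:R%:M)%R.
Proof.
have q1 := cardF_gt1 F.
apply/matrixP => i i'; rewrite mxE.
pose W := val (enum_val i) :&: val (enum_val i').
under eq_bigr => j _ do rewrite !mxE -natrM mulnb -subv_cap -/W.
rewrite (sum_bool_card (fun p : point => val p <= W)) card_points -natz.
rewrite [RHS]mxE [X in (_ + X)%R]mxE /grassmann_mx /adjmx mxE /grassmann_adj -/W.
rewrite (inj_eq enum_val_inj).
case: eqP => [eq_ii|/eqP neq] /=.
  by rewrite add0r /W eq_ii capvv dim_plane !qintS // qint0 muln0 addn0 muln1 addnC.
rewrite addr0 -dimv_eq0; suff: (\dim W < 2)%N.
  by case: (\dim W) => [|[|]] //; rewrite ?qintS ?qint0 ?muln0.
rewrite ltnNge; apply: contra neq => dW; apply/eqP/enum_val_inj/val_inj => /=.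
transitivity W; apply/eqP; last by rewrite eqEdim capvSr dim_plane.
by rewrite eq_sym eqEdim capvSl dim_plane.
Qed.

Lemma sum_incidence (i : 'I_#|plane V|) : (\sum_j B i j = (q + 1)%:R)%R.
Proof.
have q1 := cardF_gt1 F.
under eq_bigr => j _ do rewrite mxE.
rewrite (sum_bool_card (fun p : point => val p <= val (enum_val i))).
by rewrite card_points dim_plane !qintS // qint0 muln0 addn0 muln1 addnC natz.
Qed.

Lemma incidence_pair (W : {vspace V}) (j j' : 'I_#|point|) :
  (\sum_i B i j * ((val (enum_val j') <= val (enum_val i)) && (val (enum_val i) <= W))%VS%:R =
     (lines_between (val (enum_val j) + val (enum_val j')) W)%:R)%R.
Proof.
under eq_bigr => i _ do rewrite mxE -natrM mulnb andbA -subv_add.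
by rewrite (sum_bool_card (fun L : plane V => _ <= val L <= W)) natz.
Qed.

Lemma lines_between_points (W : {vspace V}) m (p p' : point) :
  \dim W = m.+1 -> val p' <= W ->
  lines_between (val p + val p') W =
    if val p <= W then if p == p' then qint q m else 1%N else 0%N.
Proof.
move=> dW p'W; case: ifP => [pW|npW]; last first.
  rewrite /lines_between (_ : [set _ | _] = set0) ?cards0 //.
  apply/setP => L; rewrite !inE subv_add; apply: contraFF npW => /andP[/andP[pL _]].
  exact: subv_trans.
case: eqP => [->|/eqP neq]; first by rewrite addvv (lines_between1 p'W dW).
by rewrite lines_between2 ?point_neq_dim // subv_add pW p'W.
Qed.

(** Two distinct points lie on exactly one line, and each point lies on [1 + q * qint q m] lines. *)
Lemma tr_incidence_mul m : \dim {:V} = m.+2 ->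
  (B^T *m B = (q * qint q m)%:R%:M + const_mx 1)%R.
Proof.
move=> dV; have q1 := cardF_gt1 F; apply/matrixP => j j'; rewrite !mxE.
transitivity (\sum_i B i j *
    ((val (enum_val j') <= val (enum_val i)) && (val (enum_val i) <= {:V}))%VS%:R)%R.
  by apply: eq_bigr => i _; rewrite mxE [B i j']mxE subvf andbT.
rewrite incidence_pair (lines_between_points _ dV) subvf // (inj_eq enum_val_inj).
by case: eqP => _; rewrite ?qintS // ?add0r // natrD addrC.
Qed.

(** Column [j] of [Z] is the vector z for the points [j] and [j0] in a 3-space [W j] containing
    both. At a point of [W j] other than these two, the two indicators contribute one line each and
    cancel; at [j] and [j0] they leave [q] and [- q]. *)
Lemma tr_incidence_right_inverse (j0 : 'I_#|point|) : (3 <= \dim {:V})%N ->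
  (exists Z : 'M[int]_(#|plane V|, #|point|),
    B^T *m Z = q%:R *: (1%:M - delta_mx j0 0 *m (const_mx 1 : 'rV_#|point|)))%R.
Proof.
move=> dV; have q1 := cardF_gt1 F.
have [|W /all_and2[jW dW]] := @fin_all_exists 'I_#|point| (fun=> {vspace V}) (fun j W =>
  (val (enum_val j) + val (enum_val j0) <= W)%VS /\ \dim W = 3).
  move=> j; have [|W jW dW] := @subspace_of_dim (val (enum_val j) + val (enum_val j0)) 3.
    by rewrite dV andbT (leq_trans (dimv_add_leqif _ _)) // !dim_point.
  by exists W.
pose Z : 'M[int]_(#|plane V|, #|point|) := (\matrix_(i, j)
  ((val (enum_val j) <= val (enum_val i) <= W j)%VS%:R -
   (val (enum_val j0) <= val (enum_val i) <= W j)%VS%:R))%R.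
exists Z; apply/matrixP => j' j; rewrite mxE.
under eq_bigr => i _ do rewrite mxE [Z i j]mxE mulrBr.
rewrite sumrB !incidence_pair.
have := jW j; rewrite subv_add => /andP[jWj j0Wj].
rewrite !(lines_between_points _ (dW j)) // !(inj_eq enum_val_inj).
rewrite !mxE big_ord1 !mxE eqxx andbT mulr1 !qintS // qint0 muln0 addn0 muln1.
case: ifP => [_|njW]; first by do 2!case: eqP => _; rewrite ?natrD ?mulr1n ?mulr0n; ring.
have /negbTE-> : j' != j by apply: contraFneq njW => ->.
have /negbTE-> : j' != j0 by apply: contraFneq njW => ->.
by rewrite subrr mulr0.
Qed.

(** The interface between geometry and matrices. The number of points is written [f.+1] so that
    columns can be split off the incidence matrix. *)
Lemma incidence_structure m : \dim {:V} = m.+3 ->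
  (exists f (C : 'M[int]_(#|plane V|, f.+1)),
    [/\ qint q m.+3 = f.+1,
        C *m C^T = grassmann_mx V + (q + 1)%:R%:M,
        C^T *m C = (q * qint q m.+1)%:R%:M + const_mx 1,
        C *m const_mx 1 = (q + 1)%:R *: (const_mx 1 : 'cV_#|plane V|)
      & forall j0, exists Z : 'M[int]_(#|plane V|, f.+1),
          C^T *m Z = q%:R *: (1%:M - delta_mx j0 0 *m (const_mx 1 : 'rV_f.+1))])%R.
Proof.
move=> dV; have q1 := cardF_gt1 F.
have card_pt : #|point| = qint q m.+3.
  rewrite -dV -card_points -cardsT; apply: eq_card => p.
  by rewrite !inE subvf.
have CCt := incidence_mul_tr; have CtC := tr_incidence_mul dV.
have C1 : (B *m const_mx 1 = (q + 1)%:R *: (const_mx 1 : 'cV_#|plane V|))%R.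
  apply/colP => i; rewrite !mxE mulr1 -(sum_incidence i).
  by apply: eq_bigr => j _; rewrite [const_mx _ _ _]mxE mulr1.
have dV3 : (3 <= \dim {:V})%N by rewrite dV.
have CZ j0 := tr_incidence_right_inverse j0 dV3.
(* The matrix is generalised first because its type depends on the number of points, which is
   nonzero by [card_pt]. *)
move: (incidence_mx) CCt CtC C1 CZ card_pt.
case: #|point| => [|f] C CCt CtC C1 CZ card_pt; last by exists f, C.
by rewrite qintS in card_pt.
Qed.

End Incidence.

(** * Elementary divisors from the incidence matrix *)

Lemma const_mx1_mul k : (const_mx 1 : 'rV[int]_k) *m (const_mx 1 : 'cV_k) = k%:R%:M.
Proof.
apply/matrixP => i j; rewrite !mxE !ord1 eqxx; under eq_bigr do rewrite !mxE mulr1.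
by rewrite sumr_const card_ord.
Qed.

Lemma const_mx1_mul_rV m n :
  (const_mx 1 : 'cV[int]_m) *m (const_mx 1 : 'rV_n) = const_mx 1.
Proof. by apply/matrixP => i j; rewrite !mxE big_ord1 !mxE mulr1. Qed.

Lemma scalemx_inj m n (s : int) : s != 0 -> injective ( *:%R s : 'M_(m, n) -> 'M_(m, n)).
Proof.
move=> nz_s C D /matrixP eqCD; apply/matrixP => i j.
by move: (eqCD i j); rewrite !mxE => /(mulfI nz_s).
Qed.

(** * Factorisations of the adjacency matrix modulo [s] *)

Section CrossCharacteristic.

Variables (l : nat) (l_prime : prime l) (d : seq int).

(** Modulo [s] the columns of [B] sum to zero, so the first column [b0] is minus the sum of the
    others and can be eliminated from [B *m B^T]. *)
Lemma count_dvd_s k N s (A : 'M[int]_N) (B : 'M[int]_(N, 1 + k)) i :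
  smith_diagonal A d -> B *m B^T = A + s%:R%:M ->
  B *m (const_mx 1 : 'cV_(1 + k)) = s%:R *: const_mx 1 ->
  (l ^ i %| s)%N -> (N <= count (fun x => (l ^ i)%:Z %| x)%Z d + k)%N.
Proof.
move=> dA; rewrite -[B]hsubmxK; move: (lsubmx B) (rsubmx B) => b0 B2 {B}.
rewrite tr_row_mx mul_row_col -col_mx_const mul_row_col => BBt B1 /dvdnP[c eq_c].
apply: (@smith_count_dvd_ge_factor l l_prime _ _ A _ i B2
  (B2 - b0 *m const_mx 1)^T (c%:R *: (const_mx 1 *m b0^T - 1%:M)) dA).
have eA : A = b0 *m b0^T + B2 *m B2^T - s%:R%:M by rewrite BBt addrK.
have eB : B2 *m const_mx 1 = s%:R *: const_mx 1 - b0.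
  rewrite -B1 [RHS]addrAC (_ : b0 *m const_mx 1 = b0) ?subrr ?add0r //.
  by apply/colP => a; rewrite mxE big_ord1 mxE mulr1 ord1.
rewrite linearB /= trmx_mul trmx_const mulmxBr mulmxA eB mulmxBl -scalemxAl scalerA.
rewrite -natz -natrM mulnC -eq_c scalerBr scalemx1 {}eA.
by apply/matrixP => a b; rewrite !mxE; ring.
Qed.

(** Modulo [s], [B] kills the all-ones vector and the image of [B^T] is orthogonal to it. As [s]
    divides the number [k.+2] of points, this vector is orthogonal to itself, so [B *m B^T] factors
    through its orthogonal space modulo its span, of dimension [k]. *)
Lemma count_dvd_s2 k N s (A : 'M[int]_N) (B : 'M[int]_(N, 1 + (1 + k))) i :
  smith_diagonal A d -> B *m B^T = A + s%:R%:M ->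
  B *m (const_mx 1 : 'cV_(1 + (1 + k))) = s%:R *: const_mx 1 ->
  (l ^ i %| s)%N -> (s %| k.+2)%N ->
  (N <= count (fun x => (l ^ i)%:Z %| x)%Z d + k)%N.
Proof.
move=> dA; rewrite -[B]hsubmxK; move: (lsubmx B) (rsubmx B) => b0 B' {B}.
rewrite -[B']hsubmxK; move: (lsubmx B') (rsubmx B') => b1 B2 {B'}.
rewrite !(tr_row_mx, mul_row_col) -!col_mx_const !mul_row_col.
move=> BBt B1 /dvdnP[c eq_c] /dvdnP[m eq_m].
have b1K (b : 'cV[int]_N) : b *m const_mx 1 = b.
  by apply/colP => a; rewrite mxE big_ord1 mxE mulr1 ord1.
rewrite !b1K in B1.
(* The right factor makes the coordinate of [b0] vanish by subtracting a multiple of the all-ones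
   vector; the left factor recovers the coordinate of [b1] from the zero coordinate sum. *)
apply: (@smith_count_dvd_ge_factor l l_prime _ _ A _ i (B2 - b1 *m const_mx 1)
  (B2 - b0 *m const_mx 1)^T
  (c%:R *: (const_mx 1 *m b0^T + b1 *m const_mx 1 - m%:R *: (b1 *m b0^T) - 1%:M)) dA).
have eA : A = b0 *m b0^T + (b1 *m b1^T + B2 *m B2^T) - s%:R%:M by rewrite BBt addrK.
have eB : B2 *m const_mx 1 = s%:R *: const_mx 1 - b0 - b1.
  by rewrite -B1; move: (B2 *m _) => M; apply/matrixP => a b; rewrite !mxE; ring.
have eBt : const_mx 1 *m B2^T = s%:R *: const_mx 1 - b0^T - b1^T.
  by rewrite -[LHS]trmxK trmx_mul trmxK trmx_const eB !linearB /= linearZ /= trmx_const.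
rewrite linearB /= trmx_mul trmx_const mulmxBr !mulmxBl mulmxA eB -[b1 *m _ *m B2^T]mulmxA eBt.
rewrite -[b1 *m _ *m _]mulmxA [const_mx 1 *m (_ *m _)]mulmxA const_mx1_mul mul_scalar_mx.
rewrite !mulmxBr !mulmxBl -!scalemxAl -!scalemxAr scalerA.
rewrite -natz -natrM mulnC -eq_c.
have ek : k%:R = m%:R * s%:R - 2%:R :> int by rewrite -natrM -eq_m -natrB // subn2.
rewrite {}ek {}eA eq_c natrM natz.
move: (b0 *m b0^T) (b1 *m b1^T) (B2 *m B2^T) (b1 *m b0^T) => M1 M2 M3 M4.
move: (const_mx 1 *m b0^T) (b1 *m const_mx 1) => M5 M6.
by apply/matrixP => a b; rewrite !mxE; ring.
Qed.

End CrossCharacteristic.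

(* A is the adjacency matrix and B the incidence matrix with the points; [x] is
   q [n - 2], so that r = x - s and k' = r + P are the other two eigenvalues. *)
Section Spectrum.

Variables (N P s r : nat) (A : 'M[int]_N) (B : 'M[int]_(N, P)).
Hypothesis s_gt0 : (0 < s)%N.
Hypothesis BBt : B *m B^T = A + s%:R%:M.
Hypothesis BtB : B^T *m B = (r + s)%:R%:M + const_mx 1.
Hypothesis B1 : B *m (const_mx 1 : 'cV_P) = s%:R *: const_mx 1.

Local Notation o := (const_mx 1 : 'cV[int]_P).
Local Notation o' := (const_mx 1 : 'rV[int]_P).

Lemma adj_sym : A^T = A.
Proof.
have -> : A = B *m B^T - s%:R%:M by rewrite BBt addrK.
by rewrite linearB /= trmx_mul trmxK tr_scalar_mx.
Qed.

Lemma s_neq0 : (s%:R : int) != 0.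
Proof. by rewrite pnatr_eq0 -lt0n. Qed.

(** It follows that [A] multiplies [B *m v] by [r] whenever the coordinates of [v] sum to zero. *)
Lemma adj_mul_incidence : A *m B = r%:R *: B + s%:R *: (const_mx 1 *m o').
Proof.
have -> : A = B *m B^T - s%:R%:M by rewrite BBt addrK.
rewrite mulmxBl -mulmxA BtB mulmxDr mul_mx_scalar mul_scalar_mx.
rewrite -(const_mx1_mul_rV P P) mulmxA B1 -scalemxAl natrD scalerDl.
by rewrite addrAC addrK.
Qed.

Lemma adj_const : A *m const_mx 1 = (r + P)%:R *: (const_mx 1 : 'cV_N).
Proof.
apply: (scalemx_inj s_neq0); rewrite scalemxAr -B1 mulmxA adj_mul_incidence.
rewrite mulmxDl -!scalemxAl -mulmxA const_mx1_mul mul_mx_scalar B1 !scalerA -scalerDl.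
by rewrite natrD; congr (_ *: _); ring.
Qed.

(** Sylvester's identity is used twice: it replaces [B *m B^T] by [B^T *m B], and then the all-ones
    matrix [o *m o'] by the scalar [P]. *)
Lemma abs_det_adj f : (0 < r)%N -> P = f.+1 ->
  (`|\det A| * s ^ P = s ^ N * (r ^ f * (r + P)))%N.
Proof.
move=> r_gt0 defP.
have detA : s%:R ^+ P * \det (- A) = s%:R ^+ N * \det (s%:R%:M - B^T *m B).
  by rewrite -det_sub_mul_comm BBt opprD addrA addrAC addrN add0r.
have := det_sub_mul_comm (- r%:R) o o'.
have -> : \det ((- r%:R)%:M - o' *m o) = - r%:R - P%:R :> int.
  by rewrite const_mx1_mul -raddfB /= det_scalar expr1.
rewrite const_mx1_mul_rV expr1.
have -> : (- r%:R)%:M - const_mx 1 = s%:R%:M - B^T *m B.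
  by rewrite BtB opprD addrA -raddfB /= natrD; congr (_%:M - _); ring.
move=> detr; have nr0 : (- r%:R : int) != 0 by rewrite oppr_eq0 pnatr_eq0 -lt0n.
have {detr} detr : \det (s%:R%:M - B^T *m B) = (- r%:R) ^+ f * (- r%:R - P%:R).
  by apply: (mulfI nr0); rewrite mulrA -exprS -defP -detr.
move: detA; rewrite detr -scaleN1r detZ => /(congr1 absz).
rewrite !abszM !abszX !abszN1 exp1n mul1n -opprD abszN -natrD abszN !natz /= => <-.
by rewrite mulnC.
Qed.

Lemma const_mul_tr_incidence : o' *m B^T = s%:R *: const_mx 1.
Proof. by rewrite -[o']trmxK -trmx_mul trmx_const B1 linearZ /= trmx_const. Qed.

(** The squared norm of [B *m o] is computed from [B *m o] itself and from [B^T *m B]. *)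
Lemma card_lines_eq : (s * s * N = P * (r + s + P))%N.
Proof.
have : o' *m B^T *m (B *m o) =
       (s * s * N)%:R%:M.
  rewrite const_mul_tr_incidence B1 -scalemxAl -scalemxAr const_mx1_mul scalerA scale_scalar_mx !natrM.
  by [].
rewrite -mulmxA (mulmxA B^T) BtB -(const_mx1_mul_rV P P) mulmxDl mul_scalar_mx.
rewrite -(mulmxA o) const_mx1_mul mul_mx_scalar -scalerDl -scalemxAr const_mx1_mul.
rewrite scale_scalar_mx => /matrixP/(_ 0 0); rewrite !mxE eqxx !mulr1n.
by rewrite -natrD -natrM => /eqP; rewrite eqr_nat => /eqP <-; rewrite mulnC.
Qed.

Section Bounds.

Variables (l : nat) (l_prime : prime l) (d : seq int) (dA : smith_diagonal A d).
Local Notation count_dvd i := (count (fun x => (l ^ i)%:Z %| x)%Z d).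

(** The transposed form of [smith_count_dvd_ge], by symmetry of [A]. *)
Lemma adj_count_dvd_ge k j i (X Y : 'M[int]_(N, k)) (W : 'M[int]_(N, k)) (c : int)
    (U : 'M[int]_(k, j)) (V : 'M[int]_(j, k)) (H : 'M[int]_k) :
  A *m X = (l ^ i)%:Z *: Y -> ~~ (l%:Z %| c)%Z ->
  X^T *m W = c%:M + U *m V + l%:Z *: H -> (k <= count_dvd i + j)%N.
Proof.
move=> AX nlc XW.
apply: (@smith_count_dvd_ge l l_prime _ _ _ A _ i X^T Y^T W c U V H dA _ nlc XW).
by rewrite -[A in LHS]adj_sym -trmx_mul AX linearZ.
Qed.

Lemma count_dvd_principal i : (0 < N)%N -> (l ^ i %| r + P)%N -> (1 <= count_dvd i)%N.
Proof.
move=> N_gt0 /dvdnP[c eq_c]; rewrite -[leqRHS]addn0.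
apply: (@adj_count_dvd_ge _ _ _ (const_mx 1) (c%:R *: const_mx 1)
  (delta_mx (Ordinal N_gt0) 0) 1 (0 : 'M_(1, 0)) 0 0).
- by rewrite adj_const eq_c natrM scalerA mulrC natz.
- by rewrite dvdzE /= Euclid_dvd1.
- rewrite mul0mx scaler0 !addr0; apply/matrixP => a b; rewrite !ord1 !mxE eqxx.
  rewrite (bigD1 (Ordinal N_gt0)) //= !mxE !eqxx big1 ?addr0 // => x nx.
  by rewrite !mxE (negbTE nx) mulr0.
Qed.

(** The columns of [E] have coordinate sum zero, so [A] acts on [B *m E] as [r]. Pairing with [B]
    gives [(r + s) *: E], which is an invertible scalar modulo [l] up to a rank-one term. *)
Lemma count_dvd_r i :
  (l ^ i %| r)%N -> ~~ (l %| P)%N -> ~~ (l %| r + s)%N -> (P <= count_dvd i + 1)%N.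
Proof.
move=> /dvdnP[c eq_c] nlP nlx.
pose E : 'M[int]_P := P%:R%:M - const_mx 1.
have oE : o' *m E = 0.
  rewrite mulmxBr -(const_mx1_mul_rV P P) mulmxA const_mx1_mul mul_mx_scalar mul_scalar_mx.
  by rewrite subrr.
have ooE : (const_mx 1 : 'M_P) *m E = 0 by rewrite -(const_mx1_mul_rV P P) -mulmxA oE mulmx0.
have EtE : E^T = E by rewrite linearB /= tr_scalar_mx trmx_const.
apply: (@adj_count_dvd_ge _ _ _ (B *m E) (c%:R *: (B *m E))
  B (P%:R * (r + s)%:R) (- (r + s)%:R *: o) o' 0).
- rewrite mulmxA adj_mul_incidence mulmxDl -!scalemxAl -mulmxA oE mulmx0 scaler0 addr0.
  by rewrite eq_c natrM scalerA mulrC natz.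
- rewrite -natrM natz dvdzE /= Euclid_dvdM // negb_or; exact/andP.
- rewrite trmx_mul -mulmxA BtB EtE mulmxDr mul_mx_scalar scaler0 addr0.
  rewrite -[E *m const_mx 1]trmxK trmx_mul EtE trmx_const ooE trmx0 addr0.
  rewrite -scalemxAl const_mx1_mul_rV scalerBr scale_scalar_mx mulrC.
  by rewrite scaleNr.
Qed.

End Bounds.

(** The columns of [q *: (B *m E) - (s * u) *: Z] are the vectors x of the outline. Since the [j0]
    column of [E] is zero, that position is used for one more vector. Independence modulo [l], up to
    one dimension, is tested against [W]. *)
Lemma count_dvd_ssu (l : nat) (l_prime : prime l) (d : seq int)
    (dA : smith_diagonal A d) i q u w (i0 : 'I_N) (j0 : 'I_P) (Z : 'M[int]_(N, P)) :
  B^T *m Z = q%:R *: (1%:M - delta_mx j0 0 *m o') ->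
  r = (s * u)%N -> (r + P)%N = (s * s * w)%N ->
  (l %| s)%N -> ~~ (l %| q)%N -> (l ^ i %| s * s * u)%N ->
  (P <= count (fun x => (l ^ i)%:Z %| x)%Z d + 1)%N.
Proof.
move=> BtZ eq_r eq_k /dvdnP[s' eq_s] nlq /dvdnP[c eq_c].
pose e : 'cV[int]_P := delta_mx j0 0.
have oe : o' *m e = 1%:M.
  apply/matrixP => a b; rewrite !ord1 !mxE (bigD1 j0) //= !mxE !eqxx big1 ?addr0 ?mulr1 //.
  by move=> x nx; rewrite !mxE (negbTE nx) mulr0.
have ete : e^T *m e = 1%:M.
  apply/matrixP => a b; rewrite !ord1 !mxE (bigD1 j0) //= !mxE !eqxx big1 ?addr0 ?mulr1 //.
  by move=> x nx; rewrite !mxE (negbTE nx) mulr0.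
rewrite -/e in BtZ.
pose E := 1%:M - e *m o'.
have oE : o' *m E = 0 by rewrite mulmxBr mulmxA oe mul1mx mulmx1 subrr.
pose n1 : 'cV[int]_N := const_mx 1; rewrite -/E in BtZ.
have B1' : B *m o = s%:R *: n1 by [].
have An1 : A *m n1 = (s * s * w)%:R *: n1 by rewrite -eq_k; exact: adj_const.
have AB := adj_mul_incidence; rewrite -/n1 in AB.
have AT1 : A *m (B *m E) = r%:R *: (B *m E).
  by rewrite mulmxA AB mulmxDl -!scalemxAl -mulmxA oE mulmx0 scaler0 addr0.
have AT2 : A *m (B *m e *m e^T) = r%:R *: (B *m e *m e^T) + s%:R *: (n1 *m e^T).
  by rewrite !mulmxA AB !mulmxDl -!scalemxAl -(mulmxA n1) oe mulmx1.
have AT3 : A *m (n1 *m e^T) = (s * s * w)%:R *: (n1 *m e^T).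
  by rewrite mulmxA An1 scalemxAl.
have AZ : A *m Z = q%:R *: (B *m E) - s%:R *: Z.
  have -> : A = B *m B^T - s%:R%:M by rewrite BBt addrK.
  by rewrite mulmxBl -mulmxA BtZ mul_scalar_mx scalemxAr.
(* The last two terms affect only column [j0]. They add [q] times [n1 - (s * w) *: (B *m e)]; here
   [w] is such that the multiples of [n1] cancel after applying [A], leaving a multiple of
   [s * s * u]. *)
pose X := q%:R *: (B *m E) - (s * u)%:R *: Z + q%:R *: (n1 *m e^T)
          - (q * s * w)%:R *: (B *m e *m e^T).
have AX : A *m X = (l ^ i)%:Z *: (c%:R *: (Z - (q * w)%:R *: (B *m e *m e^T))).
  rewrite scalerA -natz -natrM mulnC -eq_c.
  rewrite /X mulmxBr mulmxDr mulmxBr -!scalemxAr AT1 AT2 AT3 AZ eq_r.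
  move: (B *m E) (B *m e *m e^T) (n1 *m e^T) => T1 T2 T3.
  by apply/matrixP => a b; rewrite !mxE; ring.
(* [B^T *m zeta] vanishes modulo [l], while the coordinates of [zeta] sum to [q]. Adding [zeta] to
   column [j0] of [Z] therefore detects the [n1] term of [X] without disturbing the others modulo
   [l]. *)
pose zeta := q%:R *: delta_mx i0 0 - Z *m (B^T *m delta_mx i0 0) : 'cV[int]_N.
have oBt : o' *m B^T = s%:R *: n1^T by rewrite const_mul_tr_incidence trmx_const.
have Btzeta : B^T *m zeta = (q * s)%:R *: e.
  rewrite mulmxBr -scalemxAr (mulmxA B^T Z) BtZ -scalemxAl -scalerBr mulmxBl mul1mx opprB addrC addrNK.
  rewrite -mulmxA (mulmxA o') oBt -scalemxAl.
  have -> : n1^T *m delta_mx i0 0 = 1%:M :> 'M[int]_1.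
    apply/matrixP => a b; rewrite !ord1 !mxE (bigD1 i0) //= !mxE !eqxx big1 ?addr0 ?mulr1 //.
    by move=> x nx; rewrite !mxE (negbTE nx) mulr0.
  by rewrite scalemx1 mul_mx_scalar scalerA natrM.
pose W := Z + zeta *m e^T.
have BtW : B^T *m W = q%:R *: E + (q * s)%:R *: (e *m e^T).
  by rewrite mulmxDr mulmxA Btzeta BtZ scalemxAl.
have n1W : n1^T *m W = q%:R *: e^T.
  apply: (scalemx_inj s_neq0); rewrite scalemxAl -oBt -mulmxA BtW mulmxDr -!scalemxAr.
  by rewrite oE mulmxA oe mul1mx scaler0 add0r scalerA natrM mulrC.
(* Modulo [l], [X^T *m W] is [q * q] times this matrix; its rank-one part costs the one
   dimension. *)
have EtE : E^T *m E + e *m e^T = 1%:M + (o - e) *m (o - e)^T.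
  have -> : E^T = 1%:M - o *m e^T by rewrite linearB /= trmx_mul trmx1 trmx_const.
  have -> : (o - e)^T = o' - e^T by rewrite linearB /= trmx_const.
  rewrite !mulmxBr !mulmxBl !mul1mx mulmx1 -(mulmxA o) (mulmxA e^T) ete mul1mx.
  move: (o *m e^T) (e *m o') (o *m o') (e *m e^T) => T1 T2 T3 T4.
  by apply/matrixP => a b; rewrite !mxE; ring.
apply: (@adj_count_dvd_ge l l_prime d dA P 1 i X _ W (q * q)%:R
  ((q * q)%:R *: (o - e)) ((o - e)^T)
  (s'%:R *: ((q * q)%:R *: (E^T *m (e *m e^T)) - u%:R *: (Z^T *m W)
             - (q * w)%:R *: ((B *m e *m e^T)^T *m W))) AX).
  by rewrite natz dvdzE /= Euclid_dvdM // negb_or nlq.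
rewrite scalerA -natz -natrM (mulnC l) -eq_s -scalemxAl -scalemx1 -scalerDr -EtE.
have T1W : (B *m E)^T *m W = q%:R *: (E^T *m E) + (q * s)%:R *: (E^T *m (e *m e^T)).
  by rewrite trmx_mul -mulmxA BtW mulmxDr -!scalemxAr.
have T3W : (n1 *m e^T)^T *m W = q%:R *: (e *m e^T).
  by rewrite trmx_mul trmxK -mulmxA n1W scalemxAr.
have -> : X^T = q%:R *: (B *m E)^T - (s * u)%:R *: Z^T + q%:R *: (n1 *m e^T)^T
                - (q * s * w)%:R *: (B *m e *m e^T)^T.
  by apply/matrixP => a b; rewrite !mxE.
rewrite mulmxBl mulmxDl mulmxBl -!scalemxAl T1W T3W.
move: (E^T *m E) (E^T *m _) (e *m e^T) (Z^T *m W) (_ *m W) => T1 T2 T3 T4 T5.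
by apply/matrixP => a b; rewrite !mxE; ring.
Qed.

End Spectrum.

(** * Predicted valuation lists and their verification *)

Section Multiplicities.

Variables (N f s r : nat) (A : 'M[int]_N) (B : 'M[int]_(N, f.+1)).
Hypothesis s_gt0 : (0 < s)%N.
Hypothesis r_gt0 : (0 < r)%N.
Hypothesis BBt : B *m B^T = A + s%:R%:M.
Hypothesis BtB : B^T *m B = (r + s)%:R%:M + const_mx 1.
Hypothesis B1 : B *m (const_mx 1 : 'cV[int]_f.+1) = s%:R *: const_mx 1.

Local Notation P := f.+1.

Hypothesis leP : (P <= N)%N.

Lemma abs_det_eq : (`|\det A| * s ^ P = s ^ N * (r ^ f * (r + P)))%N.
Proof. exact: (abs_det_adj BBt BtB r_gt0 (erefl P)). Qed.

Lemma det_adj_neq0 : \det A != 0.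
Proof.
rewrite -absz_gt0; have : (0 < `|\det A| * s ^ P)%N.
  by rewrite abs_det_eq !muln_gt0 !expn_gt0 s_gt0 r_gt0 addnS.
by rewrite muln_gt0 => /andP[].
Qed.

Section Prime.

Variables (l : nat) (l_prime : prime l) (d : seq int) (dA : smith_diagonal A d).

Lemma logn_det_adj :
  (logn l `|\det A| + P * logn l s =
     N * logn l s + f * logn l r + logn l (r + P))%N.
Proof.
have := congr1 (logn l) abs_det_eq.
rewrite !lognM ?muln_gt0 ?expn_gt0 ?s_gt0 ?r_gt0 ?addnS ?absz_gt0 ?det_adj_neq0 //.
by rewrite !lognX addnA.
Qed.

Lemma logn_nondvd m : ~~ (l %| m)%N -> logn l m = 0%N.
Proof. by move=> nd; rewrite lognE (negbTE nd) !andbF. Qed.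

Lemma multiplicities_k i :
  ~~ (l %| s)%N -> ~~ (l %| r)%N ->
  elem_div_mult d l i = count_mem i (nseq (N - 1) 0 ++ [:: logn l (r + P)])%N.
Proof.
move=> nls nlr; apply: (smith_elem_div_mult l_prime dA det_adj_neq0).
- by rewrite size_cat size_nseq /= subnK // (leq_trans _ leP).
- have := logn_det_adj; rewrite (logn_nondvd nls) (logn_nondvd nlr).
  by rewrite sumn_cat sumn_nseq /= !muln0 !add0n addn0 => ->; rewrite addn0.
move=> k; rewrite count_cat count_nseq /= mul0n add0n addn0.
case: ltnP => // lt_k.
apply: (count_dvd_principal s_gt0 BBt BtB B1 l_prime dA); first exact: leq_trans leP.
by rewrite pfactor_dvdn // addnS.
Qed.

Lemma multiplicities_r i :
  ~~ (l %| s)%N -> ~~ (l %| P)%N -> ~~ (l %| r + s)%N -> ~~ (l %| r + P)%N ->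
  elem_div_mult d l i = count_mem i (nseq (N - f) 0 ++ nseq f (logn l r))%N.
Proof.
move=> nls nlP nlx nlk; apply: (smith_elem_div_mult l_prime dA det_adj_neq0).
- by rewrite size_cat !size_nseq subnK // ltnW.
- have := logn_det_adj; rewrite (logn_nondvd nls) (logn_nondvd nlk).
  by rewrite sumn_cat !sumn_nseq /=; lia.
move=> k; rewrite count_cat !count_nseq /= mul0n add0n.
case: ltnP => // lt_k; rewrite mul1n -ltnS -[leqRHS]addn1.
apply: (count_dvd_r BBt BtB B1 l_prime dA) => //.
by rewrite pfactor_dvdn.
Qed.

(** Here [r + P] contributes a single [logn l s] to the determinant, so the bound of [count_dvd_s]
    is already sharp. *)
Lemma multiplicities_odd i :
  ~~ (l %| r)%N -> logn l (r + P) = logn l s ->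
  elem_div_mult d l i = count_mem i (nseq f 0 ++ nseq (N - f) (logn l s))%N.
Proof.
move=> nlr eq_v; apply: (smith_elem_div_mult l_prime dA det_adj_neq0).
- by rewrite size_cat !size_nseq subnKC // ltnW.
- have := logn_det_adj; rewrite eq_v (logn_nondvd nlr).
  by rewrite sumn_cat !sumn_nseq /=; nia.
move=> k; rewrite count_cat !count_nseq /= mul0n add0n.
case: ltnP => // lt_k; rewrite mul1n leq_subLR addnC.
by apply: (count_dvd_s l_prime (B := B) dA BBt B1); rewrite pfactor_dvdn.
Qed.

(** Since [b] or [c] is zero, one list covers all cases: its last entry is [2 * a + b] when [c = 0]
    and [2 * a + c] when [b = 0]. Three bounds apply in turn as the level [k] grows, with breaks at
    [a] and [2 * a + b]. *)
Lemma multiplicities_even q u w (i0 : 'I_N) (j0 : 'I_P) (Z : 'M[int]_(N, P)) i :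
    B^T *m Z = q%:R *: (1%:M - delta_mx j0 0 *m (const_mx 1 : 'rV[int]_P)) ->
    r = (s * u)%N -> (r + P)%N = (s * s * w)%N -> (s %| P)%N ->
    (l %| s)%N -> ~~ (l %| q)%N -> (P + f <= N)%N -> (0 < f)%N ->
    logn l u = 0%N \/ logn l w = 0%N ->
    let a := logn l s in let b := logn l u in let c := logn l w in
  elem_div_mult d l i = count_mem i
    (nseq (f - 1) 0 ++ nseq (N - P - f + 2) a
     ++ nseq (f - 1) (2 * a + b) ++ [:: 2 * a + b + c])%N.
Proof.
move=> BtZ eq_r eq_k sP ls nlq le_N f_gt0 bc a b c.
have u_gt0 : (0 < u)%N by move: r_gt0; rewrite eq_r muln_gt0 => /andP[].
have w_gt0 : (0 < w)%N.
  have : (0 < r + P)%N by rewrite addnS.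
  by rewrite eq_k muln_gt0 => /andP[].
have vr : logn l r = (a + b)%N by rewrite eq_r lognM.
have vk : logn l (r + P) = (2 * a + c)%N.
  by rewrite eq_k !lognM ?muln_gt0 ?s_gt0 // addnn mul2n.
have vssu : logn l (s * s * u) = (2 * a + b)%N.
  by rewrite !lognM ?muln_gt0 ?s_gt0 // addnn mul2n.
apply: (smith_elem_div_mult l_prime dA det_adj_neq0).
- by rewrite !size_cat !size_nseq /=; lia.
- have := logn_det_adj; rewrite vr vk -/a.
  rewrite !sumn_cat !sumn_nseq /= => h.
  have [g' eq_N] : exists g', N = (P + f + g')%N by exists (N - (P + f))%N; rewrite subnKC.
  have [f' eq_f] : exists f', f = f'.+1 by exists f.-1; rewrite prednK.
  have -> : (N - P - f = g')%N by rewrite eq_N -subnDA addKn.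
  have -> : (f - 1 = f')%N by rewrite eq_f subn1.
  by move: (logn l _) h => v; rewrite eq_N eq_f; clear; nia.
move=> k; rewrite !count_cat !count_nseq /= mul0n add0n addn0.
have le1 : (k < a)%N -> (N <= count (fun x => ((l ^ k.+1)%:Z %| x)%Z) d + (f - 1))%N.
  move=> lt_ka; have sk : (l ^ k.+1 %| s)%N by rewrite pfactor_dvdn.
  (* Writing [f = f'.+1] exposes the two columns that [count_dvd_s2] eliminates. *)
  case: (f) f_gt0 B BBt B1 sP => // f' _ B' BBt' B1' sP'; rewrite subn1 /=.
  exact: (count_dvd_s2 l_prime (B := B') dA BBt' B1' sk sP').
have le2 : (k < 2 * a + b)%N -> (P <= count (fun x => ((l ^ k.+1)%:Z %| x)%Z) d + 1)%N.
  move=> lt_k; apply: (count_dvd_ssu s_gt0 BBt BtB B1 l_prime dA i0 BtZ eq_r eq_k ls nlq).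
  by rewrite pfactor_dvdn ?vssu // !muln_gt0 s_gt0.
have le3 : (k < 2 * a + c)%N -> (1 <= count (fun x => ((l ^ k.+1)%:Z %| x)%Z) d)%N.
  move=> lt_k; apply: (count_dvd_principal s_gt0 BBt BtB B1 l_prime dA).
    by rewrite (leq_trans _ leP).
  by rewrite pfactor_dvdn ?vk // addnS.
have {}bc : b = 0%N \/ c = 0%N by [].
move: (count _ d) le1 le2 le3 => D.
case: (ltnP k a) => ka le1 le2 le3.
  have k2 : (k < 2 * a + b)%N by move: ka; clear; lia.
  have k3 : (k < 2 * a + b + c)%N by apply: leq_trans k2 (leq_addr _ _).
  rewrite k2 k3; move: (le1 isT) le_N f_gt0; clear; lia.
case: (ltnP k (2 * a + b)) le2 => kb le2.
  have k3 : (k < 2 * a + b + c)%N by apply: leq_trans kb (leq_addr _ _).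
  rewrite k3; move: (le2 isT) f_gt0; clear; lia.
case: ltnP => // kc; move: le3 bc kb kc; clear; lia.
Qed.

End Prime.

End Multiplicities.

(* Arithmetic of the parameters and assembly of the cases *)
Local Close Scope ring_scope.

Lemma qint_double q k : 1 < q -> qint q (2 * k) = (q + 1) * qint (q ^ 2) k.
Proof.
move=> q1; have q2 : 1 < q ^ 2 by rewrite (ltn_exp2l 0 2).
elim: k => [|k IH]; first by rewrite muln0 !qint0 muln0.
by rewrite mulnS !qintS // IH; ring.
Qed.

Lemma card_plane_eq (F : finFieldType) (V : vectType F) m :
  \dim {:V} = m.+4 ->
  (#|F| + 1) * (#|F| + 1) * #|plane V| =
    qint #|F| m.+4 * (#|F| * qint #|F| m.+2 + qint #|F| m.+4).
Proof.
move=> dV; have q1 := cardF_gt1 F.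
have [f [C [-> CCt CtC C1 _]]] := incidence_structure dV.
(* This allows [#|F| * qint #|F| m.+2] to be written as [r + s] with [r] a natural number. *)
have le_s : #|F| + 1 <= #|F| * qint #|F| m.+2.
  by rewrite !qintS //; nia.
rewrite -(subnK le_s) in CtC *.
have s_gt0 : 0 < #|F| + 1 by rewrite addn1.
by rewrite (card_lines_eq CtC C1).
Qed.

(** Both counts satisfy the equation of [card_plane_eq], which depends only on [#|F|] and the
    dimension. *)
Lemma gauss_binom2 (F : finFieldType) (V : vectType F) m :
  \dim {:V} = m.+4 -> gauss_binom F m.+4 2 = #|plane V|.
Proof.
move=> dV; have dim_rV : \dim {:'rV[F]_m.+4} = m.+4 by rewrite dimvf /dim /= mul1n.
have -> : gauss_binom F m.+4 2 = #|plane 'rV[F]_m.+4|.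
  by rewrite card_sig; apply: eq_card => U; rewrite !inE.
apply/eqP; rewrite -(eqn_pmul2l (_ : 0 < (#|F| + 1) * (#|F| + 1))) ?muln_gt0 ?addn1 //.
by rewrite -!addn1 (card_plane_eq dV) (card_plane_eq dim_rV).
Qed.

Lemma spectrum_arith q n : 1 < q -> 4 <= n ->
  let s := q + 1 in let r := q ^ 2 * qint q (n - 3) - 1 in
  [/\ 0 < r, r + s = q * qint q (n - 2),
      r + qint q n = q * (q + 1) * qint q (n - 2)
    & 2 * (s * s) <= q * qint q (n - 2) + qint q n].
Proof.
move=> q1 n_ge4 s r; rewrite {}/r {}/s.
have [m ->] : exists m, n = m.+4 by exists (n - 4); rewrite -addn4 subnK.
have := leq0n (qint q m); rewrite !subSS subn0 !qintS //.
move: (qint q m) => c _; rewrite -mulnn.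
have h : q * q * (1 + q * c) = (q * q * (1 + q * c) - 1) + 1 by rewrite subnK // !muln_gt0 ltnW.
have qq : 1 < q * q by rewrite (ltn_mul q1 q1).
split; [by rewrite subn_gt0 (leq_trans qq) ?leq_pmulr // | by rewrite (addnC q) addnA -h; ring |
  by rewrite addnA -h; ring |].
(* The sum is [(q + 1) * qint q (n - 1)], reducing the bound to [2 * (q + 1) <= qint q (n - 1)]. *)
have -> : q * (1 + q * (1 + q * c)) + (1 + q * (1 + q * (1 + q * (1 + q * c)))) =
  (q + 1) * (1 + q * (1 + q * (1 + q * c))) by ring.
by rewrite mulnCA leq_pmul2l ?addn1 //; nia.
Qed.

Lemma multiplicities2 (e : nat -> nat) n0 n1 a :
    0 < a -> (forall i, e i = count_mem i (nseq n0 0 ++ nseq n1 a)) ->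
  [/\ e a = n1, e 0 = n0 & forall i, i \notin [:: a; 0] -> e i = 0].
Proof.
move=> a_gt0 E; split=> [||i]; rewrite ?inE ?E count_cat !count_nseq /=.
- by rewrite eqxx (ltn_eqF a_gt0) mul1n.
- by rewrite (gtn_eqF a_gt0) addn0 mul1n.
- by rewrite negb_or ![i == _]eq_sym => /andP[/negbTE-> /negbTE->].
Qed.

Lemma multiplicities3 (e : nat -> nat) n0 n1 n2 a b :
    0 < a -> a < b ->
    (forall i, e i = count_mem i (nseq n0 0 ++ nseq n1 a ++ nseq n2 b)) ->
  [/\ e b = n2, e a = n1, e 0 = n0 & forall i, i \notin [:: b; a; 0] -> e i = 0].
Proof.
move=> a_gt0 ab E; have b_gt0 := ltn_trans a_gt0 ab.
split=> [|||i]; rewrite ?inE ?E !count_cat !count_nseq /=.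
- by rewrite eqxx (ltn_eqF b_gt0) (ltn_eqF ab) mul1n.
- by rewrite eqxx (ltn_eqF a_gt0) (gtn_eqF ab) mul1n addn0.
- by rewrite (gtn_eqF a_gt0) (gtn_eqF b_gt0) mul1n addn0.
- by rewrite !negb_or ![i == _]eq_sym => /and3P[/negbTE-> /negbTE-> /negbTE->].
Qed.

Lemma multiplicities4 (e : nat -> nat) n0 n1 n2 n3 a b c :
    0 < a -> a < b -> b < c ->
    (forall i, e i = count_mem i (nseq n0 0 ++ nseq n1 a ++ nseq n2 b ++ nseq n3 c)) ->
  [/\ e c = n3, e b = n2, e a = n1, e 0 = n0
    & forall i, i \notin [:: c; b; a; 0] -> e i = 0].
Proof.
move=> a_gt0 ab bc E; have b_gt0 := ltn_trans a_gt0 ab.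
have c_gt0 := ltn_trans b_gt0 bc; have ac := ltn_trans ab bc.
split=> [||||i]; rewrite ?inE ?E !count_cat !count_nseq /=.
- by rewrite eqxx (ltn_eqF c_gt0) (ltn_eqF bc) (ltn_eqF ac) mul1n.
- by rewrite eqxx (ltn_eqF b_gt0) (ltn_eqF ab) (gtn_eqF bc) mul1n addn0.
- by rewrite eqxx (ltn_eqF a_gt0) (gtn_eqF ab) (gtn_eqF ac) mul1n addn0.
- by rewrite (gtn_eqF a_gt0) (gtn_eqF b_gt0) (gtn_eqF c_gt0) mul1n addn0.
- by rewrite !negb_or ![i == _]eq_sym => /and4P[/negbTE-> /negbTE-> /negbTE-> /negbTE->].
Qed.

Theorem mainTheorem6 (p t n l : nat) (F : finFieldType) (V : vectType F)
  (p_prime : prime p) (t_ge1 : 1 <= t) (cardF : #|F| = p ^ t)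
  (n_ge4 : 4 <= n) (dimV : \dim {:V} = n)
  (l_prime : prime l) (l_neq_p : l != p)
  (d : seq int) (d_smith : smith_diagonal (grassmann_mx V) d) :
  let q := p ^ t in
  let e i := elem_div_mult d l i in
  let f := qint q n - 1 in
  let g := gauss_binom F n 2 - qint q n in
  let k' := q * (q + 1) * qint q (n - 2) in
  let r := q ^ 2 * qint q (n - 3) - 1 in
  let a := logn l (q + 1) in
  let h := qint (q ^ 2) ((n - 2) %/ 2) in
  let b := logn l (q * h - 1) in
  let c := logn l h in
  [/\ (* (A) *)
      ~~ (l %| q + 1) ->
      [/\ ~~ (l %| k' * r) ->
            exists2 N : nat, has_order (smith_group V) N & ~~ (l %| N),
          l %| k' * r -> (l %| k') (+) (l %| r),
          l %| k' ->
            let a' := logn l k' in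
            [/\ e a' = 1, e 0 = f + g
              & forall i, i \notin [:: a'; 0] -> e i = 0]
        & l %| r ->
            let a' := logn l r in
            [/\ e a' = f, e 0 = g + 1
              & forall i, i \notin [:: a'; 0] -> e i = 0]],
      (* (B) *)
      l %| q + 1 -> ~~ odd n ->
      [/\ b = 0 \/ c = 0,
          b = 0 -> c = 0 ->
            [/\ e (2 * a) = f, e a = g - f + 2, e 0 = f - 1
              & forall i, i \notin [:: 2 * a; a; 0] -> e i = 0],
          0 < b ->
            [/\ e (2 * a + b) = f, e a = g - f + 2, e 0 = f - 1
              & forall i, i \notin [:: 2 * a + b; a; 0] -> e i = 0]
        & 0 < c ->
            [/\ e (2 * a + c) = 1, e (2 * a) = f - 1, e a = g - f + 2,
                e 0 = f - 1
              & forall i, i \notin [:: 2 * a + c; 2 * a; a; 0] -> e i = 0]]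
    & (* (C) *)
      l %| q + 1 -> odd n ->
      [/\ e a = g + 1, e 0 = f
        & forall i, i \notin [:: a; 0] -> e i = 0]].
Proof.
move=> q e f g k' r a h b c.
have q_gt0 : 0 < q by rewrite expn_gt0 prime_gt0.
have q1 : 1 < q by rewrite /q -cardF cardF_gt1.
have nlq : ~~ (l %| q).
  by rewrite Euclid_dvdX // dvdn_prime2 // (negbTE l_neq_p).
have [m eq_n] : exists m, n = m.+4 by exists (n - 4); rewrite -addn4 subnK.
have dV : \dim {:V} = m.+4 by rewrite dimV.
pose N := #|plane V|; pose P := qint q n; pose s := q + 1; pose x := qint q (n - 2).
have s_gt0 : 0 < s by rewrite /s addn1.
have card_N : gauss_binom F n 2 = N by rewrite eq_n (gauss_binom2 dV).
have eqN : s * s * N = P * (q * x + P).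
  by have := card_plane_eq dV; rewrite cardF -/q -/N /P /x eq_n !subSS subn0.
have [r_gt0 eq_r eq_k le_s] := spectrum_arith q1 n_ge4.
rewrite -/s -/x -/P -/r -/k' in eq_r eq_k le_s.
(* This bound keeps the natural-number difference [g - f] from being truncated. *)
have le_N : 2 * P <= N.
  rewrite -(leq_pmul2l (_ : 0 < s * s)) ?muln_gt0 ?s_gt0 // eqN.
  by rewrite (_ : s * s * (2 * P) = P * (2 * (s * s))) ?leq_mul2l ?le_s ?orbT //; ring.
have [f0 [C []]] := incidence_structure dV.
rewrite cardF -/q -/s -eq_n -/P => eq_f0 CCt CtC C1 CZ.
have {CtC} CtC : (C^T *m C = (r + s)%:R%:M + const_mx 1)%R.
  have ex : x = qint q m.+2 by rewrite /x eq_n !subSS subn0.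
  by rewrite eq_r ex.
have eq_f : f = f0 by rewrite /f -/P eq_f0 subn1.
have eq_g : g = N - f0.+1 by rewrite /g card_N -/P eq_f0.
have P_gt1 : 1 < P.
  by rewrite /P eq_n !qintS //; move: q1; clear; nia.
rewrite eq_f0 in eq_k le_N P_gt1.
have leP : f0.+1 <= N by apply: leq_trans le_N; rewrite mul2n -addnn leq_addr.
have f_gt0 : 0 < f0 by [].
have x_gt0 : 0 < x by rewrite /x eq_n !subSS subn0 qintS.
have k'E : k' = r + f0.+1 by [].
split=> [nls | ls n_even | ls n_odd].
(* A common divisor [l] would divide [P = s + q * q * x] and, being prime to [q] and [s], also [x];
   it would then divide [s]. *)
- have nlk_r : l %| k' -> ~~ (l %| r).
    move=> lk; apply/negP => lr.
    have lP : l %| P by move: lk; rewrite k'E -eq_f0 dvdn_addr.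
    move: lk; rewrite /k' !Euclid_dvdM // (negbTE nlq) (negbTE nls) /= => lx.
    move: lP; rewrite /P (_ : qint q n = s + q * q * x).
      by rewrite dvdn_addl ?(negbTE nls) // dvdn_mull.
    by rewrite /P /x /s eq_n !subSS subn0 !qintS //; ring.
  split.
  + rewrite Euclid_dvdM // negb_or => /andP[nlk nlr].
    exists (absz (determinant (grassmann_mx V))).
      by apply: coker_int_order; exact: (det_adj_neq0 s_gt0 r_gt0 CCt CtC).
    apply: contra nls => lN; have := abs_det_eq r_gt0 CCt CtC.
    rewrite k'E in nlk; move/(congr1 (dvdn l)); rewrite dvdn_mulr //.
    rewrite !Euclid_dvdM // (negbTE nlk) !Euclid_dvdX // (negbTE nlr) /= !orbF.
    by case/esym/andP.
  + rewrite Euclid_dvdM // => /orP[lk|lr]; first by rewrite lk (negbTE (nlk_r lk)).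
    by rewrite lr; case: (boolP (l %| k')) => // /nlk_r; rewrite lr.
  + move=> lk a'; have nlr := nlk_r lk.
    have a'_gt0 : 0 < a' by rewrite /a' -pfactor_dvdn ?expn1 // k'E addnS.
    suff -> : f + g = N - 1.
      apply: multiplicities2 a'_gt0 _ => i; rewrite /e /a' k'E.
      exact: (multiplicities_k s_gt0 r_gt0 CCt CtC C1).
    by rewrite eq_f eq_g; move: (N) leP => N'; clear; lia.
  + move=> lr a'.
    have nlk : ~~ (l %| k') by apply/negP => /nlk_r; rewrite lr.
    have a'_gt0 : 0 < a' by rewrite /a' -pfactor_dvdn ?expn1.
    have nlP : ~~ (l %| f0.+1) by apply: contra nlk; rewrite k'E dvdn_addr.
    have nlx : ~~ (l %| r + s) by rewrite dvdn_addr.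
    rewrite k'E in nlk.
    have -> : g + 1 = N - f0 by rewrite eq_g; move: (N) leP => N'; clear; lia.
    rewrite eq_f; apply: multiplicities2 a'_gt0 _ => i.
    exact: (multiplicities_r s_gt0 r_gt0 CCt CtC C1).
- have a_gt0 : 0 < a by rewrite /a -pfactor_dvdn ?expn1.
  have [k eq_k2] : exists k, n - 2 = 2 * k.
    exists (n - 2)./2; rewrite mul2n even_halfK // oddB ?(negbTE n_even) //.
    exact: leq_trans n_ge4.
  have eq_xh : x = s * h by rewrite /x /h eq_k2 mulKn // qint_double.
  have h_gt0 : 0 < h by move: x_gt0; rewrite eq_xh muln_gt0 => /andP[].
  have eq_ru : r = s * (q * h - 1).
    by rewrite mulnBr muln1 mulnCA -eq_xh -eq_r addnK.
  have eq_kw : r + f0.+1 = s * s * (q * h).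
    by rewrite -k'E /k' -/x eq_xh /s; ring.
  have sP : s %| f0.+1.
    rewrite -eq_f0; have -> : P = s + q * q * x.
      by rewrite /P /x /s eq_n !subSS subn0 !qintS //; ring.
    by rewrite dvdn_add // dvdn_mull // eq_xh dvdn_mulr.
  (* [h] and [q * h - 1] are coprime. *)
  have bc0 : b = 0 \/ c = 0.
    have [lh|nlh] := boolP (l %| h); last by right; exact: logn_nondvd.
    left; apply: logn_nondvd; apply/negP => lb.
    have : l %| (q * h - 1) + 1 by rewrite subnK ?muln_gt0 ?q_gt0 // dvdn_mull.
    by rewrite dvdn_addr // dvdn1 (gtn_eqF (prime_gt1 l_prime)).
  have vw : logn l (q * h) = c by rewrite lognM // (logn_nondvd nlq).
  (* The parameters are [u = q * h - 1] and [w = q * h]; the latter has valuation [c] because [l]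
     does not divide [q]. *)
  have E i : e i = count_mem i (nseq (f - 1) 0 ++ nseq (g - f + 2) a
      ++ nseq (f - 1) (2 * a + b) ++ nseq 1 (2 * a + b + c)).
    have N_gt0 : 0 < N by exact: leq_trans leP.
    have [Z CZ0] := CZ ord0.
    rewrite eq_g eq_f -vw.
    apply: (multiplicities_even s_gt0 r_gt0 CCt CtC C1 leP l_prime d_smith
      (Ordinal N_gt0) i CZ0 eq_ru eq_kw sP ls nlq _ f_gt0 _).
      by apply: leq_trans le_N; rewrite mul2n -addnn leq_add2l.
    by rewrite vw.
  have a2 : a < 2 * a by rewrite ltn_Pmull.
  (* When [c = 0], the last entry of the list joins the [f - 1] entries equal to [2 * a + b]. *)
  have eq1 : f - 1 + 1 = f by rewrite subnK // eq_f.
  split=> // [b0 c0 | b_gt0 | c_gt0].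
  + rewrite -[X in e (2 * a) = X]eq1; apply: multiplicities3 => // i.
    by rewrite E b0 c0 !addn0 -nseqD.
  + have c0 : c = 0 by case: bc0 b_gt0 => // ->.
    rewrite -[X in e (2 * a + b) = X]eq1; apply: multiplicities3 => // [|i].
      by rewrite (leq_trans a2) ?leq_addr.
    by rewrite E c0 !addn0 -nseqD.
  + have b0 : b = 0 by case: bc0 c_gt0 => // ->.
    apply: multiplicities4 => // [|i].
      by rewrite -[X in X < _]addn0 ltn_add2l.
    by rewrite E b0 !addn0.
- have a_gt0 : 0 < a by rewrite /a -pfactor_dvdn ?expn1.
  (* For odd [n], [x] is [1 + q * qint q (2 * k)], which is one modulo [s]. *)
  have nlx : ~~ (l %| x).
    have [k eq_k2] : exists k, n - 2 = (2 * k).+1.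
      exists (n - 3)./2; rewrite mul2n even_halfK ?oddB ?n_odd // ?subnSK //.
        exact: leq_trans n_ge4.
      exact: leq_trans n_ge4.
    rewrite /x eq_k2 qintS // qint_double // -/s dvdn_addl.
      by rewrite dvdn1 neq_ltn prime_gt1 ?orbT.
    by rewrite dvdn_mull // dvdn_mulr.
  have nlr : ~~ (l %| r).
    by rewrite -(dvdn_addl _ ls) eq_r Euclid_dvdM // (negbTE nlq).
  have vk : logn l (r + f0.+1) = logn l s.
    rewrite -k'E /k' -/x -/s !lognM ?muln_gt0 ?q_gt0 ?s_gt0 //.
    by rewrite (logn_nondvd nlq) (logn_nondvd nlx) addn0.
  have -> : g + 1 = N - f0 by rewrite eq_g; move: (N) leP => N'; clear; lia.
  rewrite eq_f; apply: multiplicities2 a_gt0 _ => i.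
  exact: (multiplicities_odd s_gt0 r_gt0 CCt CtC C1).
Qed.
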